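(* Let $G$ be an abelian group and let $\alpha = (\alpha_g : D_{g^{-1}} \to D_g)_{g\in G}$ be an outer partial action of $G$ on an associative (not necessarily unital) ring $A$ such that, for each $g\in G$, the ideal $D_g$ has local units. Then the partial skew group ring $A \star_\alpha G$ is simple if and only if $A$ is $G$-simple.
   Context: Rings are associative but not necessarily unital; ideals are two-sided. Partial action: a partial action $\alpha$ of a group $G$ (identity $e$) on a ring $A$ is a family of ideals $\{D_g\}_{g\in G}$ of $A$ and ring isomorphisms $\alpha_g : D_{g^{-1}} \to D_g$ such that for all $g,h\in G$: (i) $D_e = A$ and $\alpha_e=\mathrm{id}_A$; (ii) $\alpha_g(D_{g^{-1}}\cap D_h) = D_g\cap D_{gh}$; (iii) $\alpha_g(\alpha_h(x)) = \alpha_{gh}(x)$ for all $x\in D_{h^{-1}}\cap D_{(gh)^{-1}}$. Local units: a ring $R$ has local units if there is a set $E$ of idempotents of $R$ such that for every finite subset $F$ of $R$ there is $f\in E$ with $F\subseteq fRf$. $G$-simplicity: a subset $I\subseteq A$ is $G$-invariant if $\alpha_g(I\cap D_{g^{-1}})\subseteq I$ for all $g\in G$; $A$ is $G$-simple if it has no $G$-invariant ideal other than $A$ and $\{0\}$. Partial skew group ring: $A\star_\alpha G$ is the set of finite formal sums $\sum_{g\in G} a_g\delta_g$ with $a_g\in D_g$ and symbols $\delta_g$, with the obvious addition and with multiplication extending biadditively the rule $(a_g\delta_g)(b_h\delta_h)=\alpha_g(\alpha_{g^{-1}}(a_g)b_h)\delta_{gh}$ for $a_g\in D_g$, $b_h\in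 D_h$. Innerness at an idempotent: let $S$ be a semigroup, $I,J$ ideals of $S$, $\gamma : I\to J$ a semigroup homomorphism, and $u\in S$ an idempotent. $\gamma$ is inner at $u$ if $u\in I$ and there is an isomorphism $\beta : uS\to \gamma(u)S$ of right ideals of $S$ (i.e. a bijection with $\beta(xs)=\beta(x)s$ for $x\in uS$, $s\in S$) such that $\gamma(x)=\beta(u)\,x\,\beta^{-1}(\gamma(u))$ for all $x\in uSu$. $\gamma$ is outer at $u$ if it is not inner at $u$. Outer partial action: regard $A$ as a semigroup under multiplication. The partial action $\alpha$ is outer if there is a non-zero idempotent $u\in A$ such that for every $g\in G\setminus\{e\}$ the map $\alpha_g : D_{g^{-1}}\to D_g$ is outer at $u$. *)

(* Defs.v *)
From HB Require Import structures.
From mathcomp Require Import all_boot all_order all_algebra.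
From mathcomp Require Import finmap.
From mathcomp Require Import mathcomp_extra boolp classical_sets functions.
From mathcomp Require Import cardinality.
From mathcomp Require Import monalg.

Set Implicit Arguments.
Unset Strict Implicit.
Unset Printing Implicit Defensive.

Import GRing.Theory.

(* Products, of ring elements as well as of group elements, are those of
   group_scope; sums are those of ring_scope. *)
Local Open Scope classical_set_scope.
Local Open Scope ring_scope.
Local Open Scope group_scope.

HB.mixin Record Zmodule_Magma_isNonAssocRing R
    of GRing.Zmodule R & Magma R := {
  rngDl : forall x y z : R, (x + y) * z = (x * z)%g + (y * z)%g;
  rngDr : forall x y z : R, x * (y + z) = (x * y)%g + (x * z)%g
}.

(* Neither associativity nor a unit is required: the multiplication of a
   partial skew group ring is not associative in general (it is when every
   D_g has local units), while ideals and simplicity only use the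
   biadditive multiplication. *)
#[short(type="nonAssocRingType")]
HB.structure Definition NonAssocRing :=
  {R of GRing.Zmodule R & Magma R & Zmodule_Magma_isNonAssocRing R}.

(* Associative, not necessarily unital rings. The underlying multiplicative
   semigroup is the semigroupType structure. *)
#[short(type="rngType")]
HB.structure Definition Rng := {R of NonAssocRing R & Semigroup R}.

Definition ideal (R : nonAssocRingType) (I : set R) : Prop :=
  [/\ I 0,
      forall x y, I x -> I y -> I (x - y)
    & forall r x, I x -> I (r * x) /\ I (x * r)].

Definition simple (R : nonAssocRingType) : Prop :=
  forall I : set R, ideal I -> I = [set 0] \/ I = setT.

(* The subring S, viewed as a ring on its own, has local units: both the
   idempotents and the corner f S f are taken inside S. *)
Definition has_local_units (R : nonAssocRingType) (S : set R) : Prop :=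
  exists E : set R,
    [/\ E `<=` S,
        forall f, E f -> f * f = f
      & forall F : set R, finite_set F -> F `<=` S ->
          exists2 f, E f & F `<=` [set f * x * f | x in S]].

(* Only the restriction of pact g to pdom g^-1 is meaningful. *)
Record partial_action (G : groupType) (A : rngType) := PartialAction {
  pdom : G -> set A;
  pact : G -> A -> A;
  pdom_ideal : forall g, ideal (pdom g);
  pact_bij : forall g, set_bij (pdom g^-1) (pdom g) (pact g);
  pactD : forall g x y, pdom g^-1 x -> pdom g^-1 y ->
    pact g (x + y) = pact g x + pact g y;
  pactM : forall g x y, pdom g^-1 x -> pdom g^-1 y ->
    pact g (x * y) = pact g x * pact g y;
  pdom1 : pdom 1 = setT;
  pact1 : forall x, pact 1 x = x;
  pact_domI : forall g h,
    pact g @` (pdom g^-1 `&` pdom h) = pdom g `&` pdom (g * h);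
  pact_comp : forall g h x, pdom h^-1 x -> pdom (g * h)^-1 x ->
    pact g (pact h x) = pact (g * h) x
}.

Section PartialActionDefs.
Variables (G : groupType) (A : rngType) (alpha : partial_action G A).

Definition G_invariant (I : set A) : Prop :=
  forall g, pact alpha g @` (I `&` pdom alpha g^-1) `<=` I.

Definition G_simple : Prop :=
  forall I : set A, ideal I -> G_invariant I -> I = [set 0] \/ I = setT.

End PartialActionDefs.

Definition right_principal (S : semigroupType) (u : S) : set S :=
  [set u * s | s in setT].

Definition corner (S : semigroupType) (u : S) : set S :=
  [set u * s * u | s in setT].

(* gamma stands for a homomorphism from I to an ideal J (which plays no role
   in the definition), u for an idempotent, and beta' for beta^-1. *)
Definition inner_at (S : semigroupType) (I : set S) (gamma : S -> S) (u : S)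
    : Prop :=
  I u /\
  exists beta beta' : S -> S,
    [/\ forall x, right_principal u x -> right_principal (gamma u) (beta x),
        forall y, right_principal (gamma u) y -> right_principal u (beta' y),
        (forall x, right_principal u x -> beta' (beta x) = x) /\
        (forall y, right_principal (gamma u) y -> beta (beta' y) = y),
        forall x s, right_principal u x -> beta (x * s) = beta x * s
      & forall x, corner u x -> gamma x = beta u * x * beta' (gamma u)].

Definition outer_at (S : semigroupType) (I : set S) (gamma : S -> S) (u : S)
    : Prop := ~ inner_at I gamma u.

Definition outer (G : groupType) (A : rngType) (alpha : partial_action G A)
    : Prop :=
  exists u : A,
    [/\ u <> 0, u * u = u
      & forall g : G, g <> 1 -> outer_at (pdom alpha g^-1) (pact alpha g) u].

Section PartialSkewGroupRing.
Variables (G : groupType) (A : rngType) (alpha : partial_action G A).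

Local Notation D := (pdom alpha).
Local Notation act := (pact alpha).

(* The formal sum of the a_g delta_g is the finitely supported function
   sending g to a_g; thus << a *g g >> is a delta_g. *)
Definition skew_pred : {pred {malg A[G]}} :=
  fun a => `[< forall g, D g a@_g >].

Record partial_skew : predArgType := PartialSkew {
  skew_val :> {malg A[G]};
  _ : skew_val \in skew_pred
}.

HB.instance Definition _ := [isSub for skew_val].
HB.instance Definition _ := [Choice of partial_skew by <:].

Lemma skew_predP (a : {malg A[G]}) : reflect (forall g, D g a@_g) (a \in skew_pred).
Proof. exact: asboolP. Qed.

Lemma skew_coeff (a : partial_skew) g : D g (skew_val a)@_g.
Proof. by case: a => a /= /skew_predP. Qed.

Fact skew_zmod_closed : zmod_closed skew_pred.
Proof.
split=> [|a b /skew_predP Da /skew_predP Db]; apply/skew_predP => g.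
  by rewrite mcoeff0; case: (pdom_ideal alpha g).
by rewrite mcoeffB; case: (pdom_ideal alpha g) => _ DB _; apply: DB.
Qed.
HB.instance Definition _ :=
  GRing.isZmodClosed.Build {malg A[G]} skew_pred skew_zmod_closed.
HB.instance Definition _ := [SubChoice_isSubZmodule of partial_skew by <:].

Definition skew_coef (g : G) (a b : A) : A := act g (act g^-1 a * b).

Definition skew_mul (a b : {malg A[G]}) : {malg A[G]} :=
  (\sum_(g <- msupp a) \sum_(h <- msupp b)
      << skew_coef g a@_g b@_h *g (g * h)%g >>)%R.

Lemma pact_mem g x : D g^-1 x -> D g (act g x).
Proof. by move=> Dx; case: (pact_bij alpha g) => + _ _; apply. Qed.

Lemma pactV_mem g x : D g x -> D g^-1 (act g^-1 x).
Proof. by move=> Dx; apply: pact_mem; rewrite invgK. Qed.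

Lemma pact0 g : act g 0%R = 0%R.
Proof.
have [D0 _ _] := pdom_ideal alpha g^-1.
by have /eqP := pactD D0 D0; rewrite addr0 -subr_eq0 opprD addrA subrr sub0r
  oppr_eq0 => /eqP.
Qed.

Lemma rng0l (R : nonAssocRingType) (x : R) : 0%R * x = 0%R.
Proof.
have /eqP := rngDl 0%R 0%R x; rewrite addr0 -subr_eq0 opprD addrA subrr sub0r.
by rewrite oppr_eq0 => /eqP.
Qed.

Lemma rng0r (R : nonAssocRingType) (x : R) : x * 0%R = 0%R.
Proof.
have /eqP := rngDr x 0%R 0%R; rewrite addr0 -subr_eq0 opprD addrA subrr sub0r.
by rewrite oppr_eq0 => /eqP.
Qed.

Lemma skew_coef_dom g h a b : D g a -> D h b ->
  D g^-1 (act g^-1 a * b) /\ D h (act g^-1 a * b).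
Proof.
move=> Da Db; split.
  by have [_ _ DM] := pdom_ideal alpha g^-1; case: (DM b _ (pactV_mem Da)).
by have [_ _ DM] := pdom_ideal alpha h; case: (DM (act g^-1 a) _ Db).
Qed.

Lemma skew_coef_mem g h a b : D g a -> D h b -> D (g * h) (skew_coef g a b).
Proof.
move=> Da Db; have [Dg Dh] := skew_coef_dom Da Db.
suff [] : (D g `&` D (g * h)) (skew_coef g a b) by [].
by rewrite -pact_domI; exists (act g^-1 a * b).
Qed.

Lemma skew_coef0l g b : skew_coef g 0%R b = 0%R.
Proof. by rewrite /skew_coef pact0 rng0l pact0. Qed.

Lemma skew_coef0r g a : skew_coef g a 0%R = 0%R.
Proof. by rewrite /skew_coef rng0r pact0. Qed.

Lemma skew_coefDl g h a a' b : D g a -> D g a' -> D h b ->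
  (skew_coef g (a + a') b = skew_coef g a b + skew_coef g a' b)%R.
Proof.
move=> Da Da' Db; rewrite /skew_coef pactD ?invgK// rngDl pactD//.
  by have [] := skew_coef_dom Da Db.
by have [] := skew_coef_dom Da' Db.
Qed.

Lemma skew_coefDr g h a b b' : D g a -> D h b -> D h b' ->
  (skew_coef g a (b + b') = skew_coef g a b + skew_coef g a b')%R.
Proof.
move=> Da Db Db'; rewrite /skew_coef rngDr pactD//.
  by have [] := skew_coef_dom Da Db.
by have [] := skew_coef_dom Da Db'.
Qed.

Lemma skew_mul_closed (a b : partial_skew) :
  skew_mul (skew_val a) (skew_val b) \in skew_pred.
Proof.
rewrite /skew_mul; apply: rpred_sum => g _; apply: rpred_sum => h _.
apply/skew_predP => k; rewrite mcoeffU.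
case: eqP => [<-|_].
  by rewrite mulr1n; apply: skew_coef_mem; apply: skew_coeff.
by rewrite mulr0n; case: (pdom_ideal alpha k).
Qed.

HB.instance Definition _ := hasMul.Build partial_skew
  (fun a b => PartialSkew (skew_mul_closed a b)).

Lemma skew_mulE (a b : partial_skew) :
  skew_val (a * b) = skew_mul (skew_val a) (skew_val b).
Proof. by []. Qed.

Lemma skew_addE (a b : partial_skew) :
  skew_val (a + b)%R = (skew_val a + skew_val b)%R.
Proof. by []. Qed.

Lemma skew_val_inj : injective skew_val.
Proof. exact: val_inj. Qed.

Lemma skew_mulw (d1 d2 : {fset G}) (a b : {malg A[G]}) :
  (msupp a `<=` d1)%fset -> (msupp b `<=` d2)%fset ->
  skew_mul a b = (\sum_(g <- d1) \sum_(h <- d2)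
      << skew_coef g a@_g b@_h *g (g * h)%g >>)%R.
Proof.
move=> le_d1 le_d2; rewrite /skew_mul (big_fset_incl _ le_d1) /=.
  apply: eq_bigr => g _; apply/big_fset_incl => // h _ /mcoeff_outdom ->.
  by rewrite skew_coef0r monalgU0.
move=> g _ /mcoeff_outdom ag.
by rewrite big1 // => h _; rewrite ag skew_coef0l monalgU0.
Qed.

Lemma skew_mulUU (a b : A) (g h : G) :
  skew_mul << a *g g >>%R << b *g h >>%R =
    << act g (act g^-1 a * b)%g *g (g * h)%g >>%R.
Proof. by rewrite (skew_mulw msuppU_le msuppU_le) !big_seq_fset1 !mcoeffUU. Qed.

Fact skew_mulDl (a b c : partial_skew) : (a + b)%R * c = ((a * c)%g + (b * c)%g)%R.
Proof.
apply: skew_val_inj; rewrite skew_addE !skew_mulE skew_addE.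
set d := (msupp (skew_val a) `|` msupp (skew_val b))%fset.
rewrite (@skew_mulw d (msupp (skew_val c)) (_ + _)) ?msuppD_le//.
rewrite (@skew_mulw d (msupp (skew_val c)) (skew_val a)) ?fsubsetUl//.
rewrite (@skew_mulw d (msupp (skew_val c)) (skew_val b)) ?fsubsetUr//.
rewrite -big_split; apply: eq_bigr => g _.
rewrite -big_split; apply: eq_bigr => h _ /=.
by rewrite mcoeffD (skew_coefDl (h := h)) ?monalgUD//; apply: skew_coeff.
Qed.

Fact skew_mulDr (a b c : partial_skew) : a * (b + c)%R = ((a * b)%g + (a * c)%g)%R.
Proof.
apply: skew_val_inj; rewrite skew_addE !skew_mulE skew_addE.
set d := (msupp (skew_val b) `|` msupp (skew_val c))%fset.
rewrite (@skew_mulw (msupp (skew_val a)) d _ (_ + _)) ?msuppD_le//.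
rewrite (@skew_mulw (msupp (skew_val a)) d _ (skew_val b)) ?fsubsetUl//.
rewrite (@skew_mulw (msupp (skew_val a)) d _ (skew_val c)) ?fsubsetUr//.
rewrite -big_split; apply: eq_bigr => g _.
rewrite -big_split; apply: eq_bigr => h _ /=.
by rewrite mcoeffD (skew_coefDr (h := h)) ?monalgUD//; apply: skew_coeff.
Qed.

HB.instance Definition _ := Zmodule_Magma_isNonAssocRing.Build partial_skew
  skew_mulDl skew_mulDr.

End PartialSkewGroupRing.

(* Main.v *)
Require Import Defs.
From mathcomp Require Import all_boot all_order all_algebra.
From mathcomp Require Import finmap.
From mathcomp Require Import boolp classical_sets cardinality.
From mathcomp Require Import monalg.

(** If the skew group ring is simple, then A is G-simple because a G-invariant
    ideal I of A yields the ideal of those sums all of whose coefficients lie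
    in I ([skew_simple_G_simple]).

    Conversely, let A be G-simple and let J be a non-zero ideal of the skew
    group ring. Among the finite subsets of G that contain the support of a
    non-zero element of J, take one of least cardinality, T. Multiplying by
    delta_(h^-1) for some h in T, with a local unit as coefficient, translates
    T, so T may be assumed to contain 1.

    The coefficients at 1 of the elements of J supported in T form an ideal of
    A. Since G is abelian, conjugation by delta_g maps elements supported in T
    to elements supported in T, so this ideal is G-invariant; it is non-zero by
    minimality, hence it is A ([coefs1_minimal_support]). Applying this to the
    translates of T shows that every element of D_h is the coefficient at h of
    an element of J supported in T, for each h in T
    ([minimal_support_coef_surj]). By minimality that element is determined by
    any one of its coefficients with index in T.

    Suppose that T contains some g <> 1. Then the coefficient at g is a
    bijective function phi of the coefficient at 1, and since J is an ideal,
    phi is an isomorphism of A-bimodules from A to D_g delta_g. Such an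
    isomorphism makes alpha_g inner at every idempotent u: phi(u) and
    phi^-1(alpha_g(u)) are mutually inverse relative to u and alpha_g(u), and
    conjugation by them is alpha_g ([inner_of_twisted_iso]). This contradicts
    outerness, so T = {1}. Hence J contains A delta_1, and the local units of
    the D_g show that it contains every D_g delta_g ([ideal_eqT]). *)

Set Implicit Arguments.
Unset Strict Implicit.
Unset Printing Implicit Defensive.

Import GRing.Theory.

Local Open Scope classical_set_scope.
Local Open Scope ring_scope.
Local Open Scope group_scope.

(** * Local units and sums in ideals *)

Lemma local_unit (A : rngType) (S : set A) (x : A) :
  has_local_units S -> S x -> exists f, [/\ S f, f * x = x & x * f = x].
Proof.
move=> [E [ES Eidem Eunit]] Sx.
have [f Ef Ff] := Eunit [set x] (finite_set1 x) (ltac:(by move=> _ ->)).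
have [y _ <-] := Ff x erefl; exists f; split; first exact: ES.
  by rewrite !mulgA Eidem.
by rewrite -!mulgA Eidem.
Qed.

Lemma ideal_add (R : nonAssocRingType) (J : set R) (x y : R) :
  ideal J -> J x -> J y -> J (x + y)%R.
Proof.
move=> [J0 JB _] Jx Jy; rewrite -[y]opprK; apply: (JB _ _ Jx).
by rewrite -sub0r; apply: JB.
Qed.

(** * Coefficients in the skew group ring *)

Section Skew.
Variables (G : groupType) (A : rngType) (alpha : partial_action G A).

Local Notation D := (pdom alpha).
Local Notation act := (pact alpha).
Local Notation skew := (partial_skew alpha).
Local Notation coef := (skew_coef alpha).
Implicit Types (g h k : G) (x y f r : A) (a b : skew) (T : {fset G}).

Lemma pactK g x : D g^-1 x -> act g^-1 (act g x) = x.
Proof.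
by move=> Dx; rewrite pact_comp ?mulVg ?pact1// invg1 pdom1.
Qed.

Lemma pactVK g x : D g x -> act g (act g^-1 x) = x.
Proof. by move=> Dx; have := @pactK g^-1 x; rewrite !invgK; apply. Qed.

Lemma pdomMl g r x : D g x -> D g (r * x).
Proof. by move=> Dx; have [_ _ /(_ r x Dx) []] := pdom_ideal alpha g. Qed.

Lemma pdomMr g x r : D g x -> D g (x * r).
Proof. by move=> Dx; have [_ _ /(_ r x Dx) []] := pdom_ideal alpha g. Qed.

(** When the right factor lies in the domain of the action of [g], the twisted
    product unwinds to [y delta_g x = y alpha_g(x) delta_g]. *)
Lemma skew_coef_pact g y x : D g y -> D g^-1 x -> coef g y x = y * act g x.
Proof.
by move=> Dy Dx; rewrite /skew_coef pactM ?pactVK//; apply: pactV_mem.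
Qed.

Lemma skew_coef1l y x : coef 1 y x = y * x.
Proof. by rewrite /skew_coef invg1 !pact1. Qed.

Fact skew_monom_subproof g x (Dx : D g x) : << x *g g >>%R \in skew_pred alpha.
Proof.
apply/skew_predP => k; rewrite mcoeffU; case: eqP => [<-|_] //=.
by case: (pdom_ideal alpha k).
Qed.

Definition skew_monom g x (Dx : D g x) : skew :=
  PartialSkew (skew_monom_subproof Dx).

Lemma skew_eqP a b : (forall k, a@_k = b@_k)%R -> a = b.
Proof. by move=> eqab; apply: skew_val_inj; apply/malgP. Qed.

Lemma coeffM_monomr a g x (Dx : D g x) k :
  (skew_val (a * skew_monom Dx))@_k = coef (k * g^-1) a@_(k * g^-1) x.
Proof.
rewrite skew_mulE (@skew_mulw _ _ _ (k * g^-1 |` msupp a)%fset [fset g]%fset);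
  [|exact: fsubsetU1 |exact: msuppU_le].
rewrite raddf_sum (big_fsetD1 (k * g^-1)) ?fset1U1//= big_seq_fset1.
rewrite mcoeffUU mcoeffU mulgVK eqxx mulr1n big_seq big1 ?addr0// => h.
rewrite in_fsetD1 => /andP[hk _]; rewrite big_seq_fset1 mcoeffUU mcoeffU.
by case: eqP => // hg; case/eqP: hk; rewrite -hg mulgK.
Qed.

Lemma coeffM_monoml a g x (Dx : D g x) k :
  (skew_val (skew_monom Dx * a))@_k = coef g x a@_(g^-1 * k).
Proof.
rewrite skew_mulE (@skew_mulw _ _ _ [fset g]%fset (g^-1 * k |` msupp a)%fset);
  [|exact: msuppU_le |exact: fsubsetU1].
rewrite big_seq_fset1 raddf_sum (big_fsetD1 (g^-1 * k)) ?fset1U1//=.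
rewrite mcoeffUU mcoeffU mulVKg eqxx mulr1n big_seq big1 ?addr0// => h.
rewrite in_fsetD1 => /andP[hk _]; rewrite mcoeffU.
by case: eqP => // hg; case/eqP: hk; rewrite -hg mulKg.
Qed.

Lemma skew_sum_monom a :
  a = (\sum_(g <- msupp a) skew_monom (skew_coeff a g))%R.
Proof.
apply: skew_val_inj.
rewrite (big_morph _ (@skew_addE _ _ alpha) erefl) /=.
exact: (monalgE (skew_val a)).
Qed.

(** * Simplicity of the skew group ring implies G-simplicity *)

(** The witness is the ideal of all elements with coefficients in [I];
    invariance of [I] is what makes it absorb products, as their coefficients
    are of the form [alpha_g(alpha_(g^-1)(x) y)]. *)
Lemma skew_simple_G_simple : simple skew -> G_simple alpha.
Proof.
move=> simp I idI invI; have [I0 IB IM] := idI.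
have [|J0|JT] := simp [set a | forall k, I (skew_val a)@_k]%R.
- split=> [k|a b Ia Ib k|r a Ia]; first by rewrite mcoeff0.
    by rewrite mcoeffB; apply: IB.
  have Iact g x : I x -> D g^-1 x -> I (act g x).
    by move=> Ix Dx; apply: (invI g); exists x.
  split=> k; rewrite skew_mulE /skew_mul raddf_sum /=;
    apply: (big_ind I) => // [x y|g _]; try exact: ideal_add;
    rewrite raddf_sum /=; apply: (big_ind I) => // [x y|h _];
    try exact: ideal_add; rewrite mcoeffU; case: eqP => // _; apply: (Iact).
  + by have [] := IM (act g^-1 r@_g)%R _ (Ia h).
  + exact/pdomMr/pactV_mem/skew_coeff.
  + have /(IM r@_h)[] : I (act g^-1 a@_g).
      by apply: Iact (Ia g) _; rewrite invgK; apply: skew_coeff.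
    by [].
  + exact/pdomMr/pactV_mem/skew_coeff.
- left; apply/seteqP; split=> [x Ix|_ ->//].
  have Dx : D 1 x by rewrite pdom1.
  have : [set a | forall k, I (skew_val a)@_k]%R (skew_monom Dx).
    by move=> k /=; rewrite mcoeffU; case: eqP.
  rewrite J0 => /(congr1 (fun a : skew => (skew_val a)@_1)) /=.
  by rewrite mcoeffUU mcoeff0.
- right; apply/seteqP; split=> // x _.
  have Dx : D 1 x by rewrite pdom1.
  have : [set a | forall k, I (skew_val a)@_k]%R (skew_monom Dx) by rewrite JT.
  by move=> /(_ 1) /=; rewrite mcoeffUU.
Qed.

(** * Twisted bimodule isomorphisms give inner actions *)

(** Here [phi] stands for a bijection from [A] to [D_g delta_g] that commutes
    with left and right multiplication by elements of [A]. With [b = phi u],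
    [v = alpha_g u] and [c = phi^-1 v], it satisfies [b c = u], [c b = v] and
    [c x b = alpha_g x] for [x] in the corner of [u], so left multiplication by
    [c] is the required isomorphism of right ideals. *)
Lemma inner_of_twisted_iso g u (phi : A -> A) :
  has_local_units (D g^-1) -> u * u = u ->
  injective phi -> (forall x, D g (phi x)) ->
  (forall y, D g y -> exists x, phi x = y) ->
  (forall r x, phi (r * x) = r * phi x) ->
  (forall x r, phi (x * r) = coef g (phi x) r) ->
  inner_at (D g^-1) (act g) u.
Proof.
move=> lu uu phi_inj Dphi phi_surj phiMl phiMr.
(* A right local unit [f] of [alpha_(g^-1)(phi u)] gives [phi (u f) = phi u],
   hence [u = u f]. *)
have Du : D g^-1 u.
  have [f [Df _ uf]] := local_unit lu (pactV_mem (Dphi u)).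
  have <- : u * f = u; last exact: pdomMl.
  by apply: phi_inj; rewrite phiMr /skew_coef uf pactVK.
have phiMact x r : D g^-1 r -> phi (x * r) = phi x * act g r.
  by move=> Dr; rewrite phiMr skew_coef_pact.
have [c phic] := phi_surj _ (pact_mem Du).
set b := phi u; set v := act g u in phic *.
have vv : v * v = v by rewrite /v -pactM// uu.
have ub : u * b = b by rewrite -phiMl uu.
have bv : b * v = b by rewrite -phiMact// uu.
have vc : v * c = c by apply: phi_inj; rewrite phiMl phic.
have cu : c * u = c by apply: phi_inj; rewrite phiMact// phic.
have bc : b * c = u by apply: phi_inj; rewrite phiMl phic bv.
have cb : c * b = v by rewrite -phiMl cu.
split=> //; exists (fun x => c * x), (fun y => b * y); split.
- by move=> x _; exists (c * x); rewrite // mulgA vc.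
- by move=> y _; exists (b * y); rewrite // mulgA ub.
- by split=> [_ [s _ <-]|_ [s _ <-]]; rewrite !mulgA ?bc ?cb ?uu ?vv.
- by move=> x s _; rewrite mulgA.
- move=> _ [s _ <-]; set x := u * s * u.
  have ux : u * x = x by rewrite /x !mulgA uu.
  have xu : x * u = x by rewrite /x -!mulgA uu.
  have Dx : D g^-1 x by rewrite -xu; apply: pdomMl.
  by rewrite bv cu -mulgA -!phiMl xu phiMact// phic -pactM// ux.
Qed.

(** * Translated supports *)

Section Translate.
Hypothesis comG : forall g h, g * h = h * g.

Definition translate T h : {fset G} := [fset k * h | k in T]%fset.

Lemma mem_translate T h k : (k \in translate T h) = (k * h^-1 \in T).
Proof.
apply/imfsetP/idP => [[l /= lT ->]|kT]; first by rewrite mulgK.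
by exists (k * h^-1); rewrite ?mulgVK.
Qed.

Lemma translate1 T : translate T 1 = T.
Proof. by apply/fsetP => k; rewrite mem_translate invg1 mulg1. Qed.

Lemma translateK T h : translate (translate T h) h^-1 = T.
Proof. by apply/fsetP => k; rewrite !mem_translate invgK mulgK. Qed.

Lemma card_translate T h : #|` translate T h| = #|` T|.
Proof. by rewrite card_imfset //; apply: mulIg. Qed.

(** * Elements of an ideal with minimal support *)

Section Ideal.
Variable J : set skew.
Hypothesis idJ : ideal J.

Definition supported T : set skew :=
  [set a | J a /\ forall k, k \notin T -> (skew_val a)@_k = 0].

Lemma supportedB T a b :
  supported T a -> supported T b -> supported T (a - b)%R.
Proof.
move=> [Ja a0] [Jb b0]; have [_ JB _] := idJ; split; first exact: JB.
by move=> k kT; rewrite mcoeffB a0// b0// subrr.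
Qed.

(** Left multiplication by [x delta_g] would translate the support on the left;
    commutativity of [G] turns this into a translation on the right. *)
Lemma supported_mull T a g x (Dx : D g x) :
  supported T a -> supported (translate T g) (skew_monom Dx * a).
Proof.
move=> [Ja a0]; have [_ _ JM] := idJ.
split=> [|k]; first by have [] := JM (skew_monom Dx) a Ja.
by rewrite mem_translate coeffM_monoml comG => /a0 ->; rewrite skew_coef0r.
Qed.

Lemma supported_mulr T a g x (Dx : D g x) :
  supported T a -> supported (translate T g) (a * skew_monom Dx).
Proof.
move=> [Ja a0]; have [_ _ JM] := idJ.
split=> [|k]; first by have [] := JM (skew_monom Dx) a Ja.
by rewrite mem_translate coeffM_monomr => /a0 ->; rewrite skew_coef0l.
Qed.

Definition coefs1 T : set A :=
  [set x | exists2 a, supported T a & (skew_val a)@_1 = x].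

(** Minimality is in cardinality rather than for inclusion, so that it can be
    transported to the translates of [T]. *)
Definition minimal_support T :=
  (exists2 a, supported T a & a <> 0) /\
  forall T' a, (#|` T'| < #|` T|)%N -> supported T' a -> a = 0.

Lemma minimal_support_exists : J <> [set 0] -> exists T, minimal_support T.
Proof.
move=> J_neq0.
pose P n := `[< exists T a, [/\ #|` T| = n, supported T a & a <> 0] >].
have exP : exists n, P n.
  apply: contrapT => noP; apply: J_neq0.
  apply/seteqP; split=> [a Ja|_ ->]; last by case: idJ.
  apply: contrapT => a0; apply: noP; exists #|` msupp (skew_val a)|.
  apply/asboolP; exists (msupp (skew_val a)), a; split=> //; split=> // k.
  exact: mcoeff_outdom.
case: (ex_minnP exP) => n /asboolP[T [a [<- Ta a0]]] nmin.
exists T; split=> [|T' b ltT Tb]; first by exists a.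
apply: contrapT => b0; suff /nmin : P #|` T'| by rewrite leqNgt ltT.
by apply/asboolP; exists T', b.
Qed.

(** An element with a vanishing coefficient at [k] is supported in [T] minus
    [k], which is too small. *)
Lemma minimal_support_coef0 T a k :
  minimal_support T -> k \in T -> supported T a ->
  (skew_val a)@_k = 0 -> a = 0.
Proof.
move=> [_ minT] kT [Ja a0] ak; apply: (minT (T `\ k)%fset).
  by rewrite [X in (_ < X)%N](cardfsD1 k) kT.
split=> // l; rewrite in_fsetD1 negb_and negbK => /orP[/eqP ->//|]; exact: a0.
Qed.

Lemma minimal_support_eq T a b k :
  minimal_support T -> k \in T -> supported T a -> supported T b ->
  (skew_val a)@_k = (skew_val b)@_k -> a = b.
Proof.
move=> minT kT Ta Tb abk; apply/eqP; rewrite -subr_eq0; apply/eqP.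
apply: minimal_support_coef0 minT kT (supportedB Ta Tb) _.
by rewrite mcoeffB abk subrr.
Qed.

Section LocalUnits.
Hypothesis lu : forall g, has_local_units (D g).

(** Multiplying by [f delta_h], with [f] in [D_h] a right local unit of
    [alpha_(k^-1)(a_k)], moves the coefficient at [k] unchanged to [k h]. The
    hypothesis holds for [h = k^-1], and for [k = 1] when [a_1] is in [D_h]. *)
Lemma supported_shift T a k h :
  supported T a -> D h (act k^-1 (skew_val a)@_k) ->
  exists2 b, supported (translate T h) b &
    (skew_val b)@_(k * h) = (skew_val a)@_k.
Proof.
move=> Ta /(local_unit (lu h))[f [Df _ af]].
exists (a * skew_monom Df); first exact: supported_mulr.
by rewrite coeffM_monomr mulgK /skew_coef af pactVK//; apply: skew_coeff.
Qed.

Lemma coefs1_ideal T : ideal (coefs1 T).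
Proof.
have [J0 _ _] := idJ; split.
- by exists 0%R; [split=> // k _|]; rewrite mcoeff0.
- move=> _ _ [a Ta <-] [b Tb <-].
  by exists (a - b)%R; [exact: supportedB|rewrite mcoeffB].
- move=> r _ [a Ta <-]; have Dr : D 1 r by rewrite pdom1.
  split; rewrite -[T]translate1.
    exists (skew_monom Dr * a); first exact: supported_mull.
    by rewrite coeffM_monoml invg1 mulg1 skew_coef1l.
  exists (a * skew_monom Dr); first exact: supported_mulr.
  by rewrite coeffM_monomr invg1 mulg1 skew_coef1l.
Qed.

(** Let [x] be the coefficient at 1 of [a] and [f] a local unit of [x] in
    [D_(g^-1)]. Then [(alpha_g(f) delta_g) a (f delta_(g^-1))] has coefficient
    [alpha_g(f x f) = alpha_g(x)] at 1, and its support stays in [T] because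
    the two translations, by [g] and by [g^-1], cancel. *)
Lemma coefs1_invariant T : G_invariant alpha (coefs1 T).
Proof.
move=> g _ [_ [[a Ta <-] Dx] <-]; set x := (skew_val a)@_1 in Dx *.
have [f [Df fx xf]] := local_unit (lu _) Dx.
have Dgf := pact_mem Df.
exists (skew_monom Dgf * a * skew_monom Df).
  by rewrite -(translateK T g); apply/supported_mulr/supported_mull.
rewrite coeffM_monomr coeffM_monoml invgK mul1g mulVg -/x.
rewrite (skew_coef_pact Dgf Dx) -pactM// fx.
by rewrite (skew_coef_pact (pact_mem Dx) Df) -pactM// xf.
Qed.

Lemma minimal_support_translate T h :
  minimal_support T -> h \in T -> minimal_support (translate T h^-1).
Proof.
move=> minT hT; have [[a Ta a0] card_min] := minT; split; last first.
  by move=> T' b; rewrite card_translate; apply: card_min.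
have [|b Tb] := @supported_shift T a h h^-1 Ta.
  exact/pactV_mem/skew_coeff.
rewrite mulgV => bE; exists b => // b0; apply: a0.
by apply: minimal_support_coef0 minT hT Ta _; rewrite -bE b0 mcoeff0.
Qed.

(** * G-simplicity implies simplicity of the skew group ring *)

Section Simple.
Hypothesis simpA : G_simple alpha.

Lemma coefs1_minimal_support T :
  minimal_support T -> 1 \in T -> coefs1 T = setT.
Proof.
move=> minT T1; have [I0|//] := simpA (coefs1_ideal T) (@coefs1_invariant T).
have [[a Ta a0] _] := minT; case: a0.
apply: (minimal_support_coef0 minT T1 Ta).
have : coefs1 T (skew_val a)@_1 by exists a.
by rewrite I0.
Qed.

(** The translate of [T] by [h^-1] is again minimal and contains 1, so [y] is
    the coefficient at 1 of an element supported there; translating back by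
    [h] moves it to the coefficient at [h], as [y] lies in [D_h]. *)
Lemma minimal_support_coef_surj T h y :
  minimal_support T -> h \in T -> D h y ->
  exists2 a, supported T a & (skew_val a)@_h = y.
Proof.
move=> minT hT Dy.
have : coefs1 (translate T h^-1) y.
  rewrite coefs1_minimal_support//; first exact: minimal_support_translate.
  by rewrite mem_translate invgK mul1g.
move=> [a Ta ay]; have [|b] := @supported_shift _ a 1 h Ta.
  by rewrite invg1 pact1 ay.
have := translateK T h^-1; rewrite invgK => ->.
by rewrite mul1g ay => ? ?; exists b.
Qed.

(** Each [x] in [A] is the coefficient at 1 of exactly one element [s x] of the
    ideal supported in [T]. Sending [x] to the coefficient of [s x] at [g] is
    bimodule linear, since multiplying [s x] by [r delta_1] on either side
    preserves the support. *)
Lemma minimal_support_inner T g u :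
  minimal_support T -> 1 \in T -> g \in T -> u * u = u ->
  inner_at (D g^-1) (act g) u.
Proof.
move=> minT T1 Tg uu.
have /choice[s sP] x : exists a, supported T a /\ (skew_val a)@_1 = x.
  have [|a Ta ax] := minimal_support_coef_surj (y := x) minT T1.
    by rewrite pdom1.
  by exists a.
have Ts x := (sP x).1; have s1 x := (sP x).2.
have s_uniq x a : supported T a -> (skew_val a)@_1 = x -> s x = a.
  by move=> Ta ax; apply: minimal_support_eq minT T1 (Ts x) Ta _; rewrite s1.
apply: (@inner_of_twisted_iso g u (fun x => (skew_val (s x))@_g)) => //.
- move=> x y sxy; rewrite -(s1 x) -(s1 y).
  by rewrite (minimal_support_eq minT Tg (Ts x) (Ts y) sxy).
- by move=> x; apply: skew_coeff.
- move=> y Dy; have [a Ta ay] := minimal_support_coef_surj minT Tg Dy.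
  by exists (skew_val a)@_1; rewrite (s_uniq _ a).
- move=> r x; have Dr : D 1 r by rewrite pdom1.
  rewrite (s_uniq _ (skew_monom Dr * s x)).
  + by rewrite coeffM_monoml invg1 mul1g skew_coef1l.
  + by rewrite -[T]translate1; apply: supported_mull.
  + by rewrite coeffM_monoml invg1 mul1g skew_coef1l s1.
- move=> x r; have Dr : D 1 r by rewrite pdom1.
  rewrite (s_uniq _ (s x * skew_monom Dr)).
  + by rewrite coeffM_monomr invg1 mulg1.
  + by rewrite -[T]translate1; apply: supported_mulr.
  + by rewrite coeffM_monomr invg1 mulg1 skew_coef1l s1.
Qed.

(** When [T = {1}], the ideal contains [x delta_1] for every [x] in
    [A]; for [x] in [D_g] with right local unit [f] in [D_g], it then contains
    [(x delta_1)(f delta_g) = x delta_g]. *)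
Lemma ideal_eqT T :
  minimal_support T -> 1 \in T -> (forall k, k \in T -> k = 1) -> J = setT.
Proof.
move=> minT T1 subT; apply/seteqP; split=> // a _; have [J0 _ JM] := idJ.
rewrite (skew_sum_monom a).
apply: big_ind => // [b c|g _]; first exact: ideal_add.
have [f [Df _ af]] := local_unit (lu g) (skew_coeff a g).
set x := (skew_val a)@_g in af *.
have [|c [Jc c0] cx] := minimal_support_coef_surj (y := x) minT T1.
  by rewrite pdom1.
suff <- : c * skew_monom Df = skew_monom (skew_coeff a g).
  by have [] := JM (skew_monom Df) _ Jc.
apply: skew_eqP => k; rewrite coeffM_monomr mcoeffU.
have [<-|/eqP gk] := eqVneq g k; first by rewrite mulgV skew_coef1l cx.
rewrite c0 ?skew_coef0l//; apply/negP => /subT kg.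
by apply: gk; rewrite -[k](mulgVK g) kg mul1g.
Qed.

End Simple.
End LocalUnits.
End Ideal.
End Translate.
End Skew.

Theorem theorem1p2 (G : groupType) (A : rngType) (alpha : partial_action G A) :
  (forall g h : G, (g * h = h * g)%g) ->
  outer alpha ->
  (forall g : G, has_local_units (pdom alpha g)) ->
  (simple (partial_skew alpha) <-> G_simple alpha).
Proof.
move=> comG [u [_ uu out]] lu; split; first exact: skew_simple_G_simple.
move=> simpA J idJ; have [|J_neq0] := pselect (J = [set 0]); first by left.
right; have [T0 minT0] := minimal_support_exists idJ J_neq0.
have [h hT0] : exists h, h \in T0.
  apply: contrapT => T0_empty; have [[a [_ a0] a_neq0] _] := minT0.
  apply: a_neq0; apply: skew_eqP => k; rewrite mcoeff0; apply: a0.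
  by apply/negP => kT0; apply: T0_empty; exists k.
pose T := translate T0 h^-1.
have minT : minimal_support J T by exact: minimal_support_translate.
have T1 : 1 \in T by rewrite mem_translate invgK mul1g.
apply: (ideal_eqT comG idJ lu simpA minT T1) => g Tg.
apply: contrapT => /out; apply.
exact: (minimal_support_inner comG idJ lu simpA minT T1 Tg uu).
Qed.
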